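(* Let $\mathfrak{C}$ be an $(\!(n,k)\!)$ code on $n$ qubits placed on the sites of a $D$-dimensional integer lattice with adjacency graph $\mathsf G_D$ (nearest-neighbour edges; the topology of the base manifold, e.g. periodic boundary conditions, is arbitrary). Let $d\ge1$, $\delta\ge 0$. If $\varepsilon_{\mathsf G_D}(\mathfrak{C},d)+\delta<1$ and $$H_2\!\left(\tfrac{\varepsilon_{\mathsf G_D}(\mathfrak{C},d)}{2}+\tfrac{\delta}{2}\right)<\frac{k}{n},$$ then every code state $|\psi\rangle\in\mathfrak{C}$ satisfies $\mathscr{C}^{\delta}_{\mathsf G_D}(\psi)>(d^{1/D}-1)/2$.
   Context: An $(\!(n,k)\!)$ code is a $2^k$-dimensional subspace $\mathfrak{C}$ of $(\mathbb{C}^2)^{\otimes n}$, $k<n$. Logarithms are base 2 and $H_2(p)=-p\log p-(1-p)\log(1-p)$. Let $\Gamma=\Pi/2^k$ be the maximally mixed state on $\mathfrak{C}$. For an adjacency graph $\mathsf G$, the subsystem variance is $\varepsilon_{\mathsf G}(\mathfrak{C},d)=\max\{\|\psi_S-\Gamma_S\|_1 : |\psi\rangle\in\mathfrak{C}, S\text{ connected in }\mathsf G, |S|\le d\}$ (reduced states on $S$). The circuit complexity $\mathscr{C}_{\mathsf G}(\psi)$ is the minimum depth $l$ with $|\psi\rangle=U_l\cdots U_1|0\rangle^{\otimes n}$, each layer $U_i$ a tensor product of 2-qubit unitaries on disjoint pairs of qubits adjacent in $\mathsf G$; the $\delta$-robust complexity $\mathscr{C}^\delta_{\mathsf G}(\psi)$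 is the minimum of $\mathscr{C}_{\mathsf G}(\psi')$ over pure $\psi'$ with $\|\psi'-\psi\|_1\le\delta$. *)

(* Defs.v *)
From Stdlib Require Import ClassicalEpsilon.
From mathcomp Require Import all_boot all_order all_algebra.
From mathcomp Require Import all_classical all_reals.
From mathcomp Require Import exp.
From mathcomp Require Import complex.
Set Implicit Arguments. Unset Strict Implicit. Unset Printing Implicit Defensive.
Import Order.TTheory GRing.Theory Num.Theory.
Local Open Scope ring_scope.

Section QuantumDefs.
Variable R : realType.
Local Notation C := (R[i]).

Definition vec (T : finType) := T -> C.
Definition op (T : finType) := T -> T -> C.

Definition op_mul (T : finType) (A B : op T) : op T :=
  fun x y => \sum_(z : T) A x z * B z y.
Definition op_adj (T : finType) (A : op T) : op T := fun x y => (A y x)^*.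
Definition op_sub (T : finType) (A B : op T) : op T := fun x y => A x y - B x y.
Definition op_tr (T : finType) (A : op T) : C := \sum_(x : T) A x x.
Definition proj_op (T : finType) (v : vec T) : op T := fun x y => v x * (v y)^*.
Definition inner (T : finType) (u v : vec T) : C := \sum_(x : T) (u x)^* * v x.

Definition psd (T : finType) (A : op T) : Prop :=
  op_adj A = A /\
  forall v : vec T, 0 <= \sum_(x : T) \sum_(y : T) (v x)^* * A x y * v y.

Definition op_sqrt (T : finType) (M : op T) : op T :=
  epsilon (inhabits (fun _ _ => 0 : C)) (fun B => psd B /\ op_mul B B = M).

(* trace norm ||A||_1 = tr sqrt(A^dagger A)  (real part taken to land in R;
   the value is real and nonnegative) *)
Definition trnorm (T : finType) (A : op T) : R :=
  complex.Re (op_tr (op_sqrt (op_mul (op_adj A) A))).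

(* computational basis of (C^2)^{(x)n} : bit strings *)
Definition bits (n : nat) := {ffun 'I_n -> bool}.

Definition sbits (n : nat) (S : {set 'I_n}) := {ffun {i : 'I_n | i \in S} -> bool}.

Definition restr (n : nat) (S : {set 'I_n}) (x : bits n) : sbits S :=
  [ffun j => x (val j)].

Definition override (n : nat) (S : {set 'I_n}) (b : sbits S) (x : bits n) : bits n :=
  [ffun i => if @insub _ (fun i => i \in S) _ i is Some j then b j else x i].

Arguments restr : clear implicits.
Arguments override : clear implicits.

Definition ptrace (n : nat) (S : {set 'I_n}) (rho : op (bits n)) : op (sbits S) :=
  fun a b => \sum_(x : bits n | restr n S x == a) rho x (override n S b x).
Arguments ptrace : clear implicits.

(* An ((n,k)) code is a 2^k-dimensional subspace of (C^2)^{(x)n}; we present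
   it by an orthonormal_family basis  basis : 'I_(2^k) -> vec (bits n). *)
Definition orthonormal_family (n m : nat) (basis : 'I_m -> vec (bits n)) : Prop :=
  forall i j, inner (basis i) (basis j) = (i == j)%:R.

Definition code_state (n m : nat) (basis : 'I_m -> vec (bits n)) (psi : vec (bits n))
  : Prop :=
  (exists c : 'I_m -> C, psi = fun x => \sum_(i < m) c i * basis i x) /\
  inner psi psi = 1.

Definition code_mixed (n m : nat) (basis : 'I_m -> vec (bits n)) : op (bits n) :=
  fun x y => (m%:R)^-1 * \sum_(i < m) basis i x * (basis i y)^*.

Definition connected_in (n : nat) (G : rel 'I_n) (S : {set 'I_n}) : bool :=
  [forall x in S, forall y in S,
     connect [rel a b | [&& G a b, a \in S & b \in S]] x y].

Definition subsys_values (n m : nat) (G : rel 'I_n) (basis : 'I_m -> vec (bits n))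
  (d : nat) : set R :=
  [set e | exists (psi : vec (bits n)) (S : {set 'I_n}),
     [/\ code_state basis psi, connected_in G S, (#|S| <= d)%N &
         e = trnorm (op_sub (ptrace n S (proj_op psi))
                            (ptrace n S (code_mixed basis)))]].

(* subsystem variance (the max is attained; we write it as the supremum) *)
Definition subsys_variance (n m : nat) (G : rel 'I_n) (basis : 'I_m -> vec (bits n))
  (d : nat) : R := sup (subsys_values G basis d).

Definition unitary2 (u : bool * bool -> bool * bool -> C) : Prop :=
  forall a b, \sum_(c : bool * bool) (u c a)^* * u c b = (a == b)%:R.

Record gate (n : nat) := Gate { gq1 : 'I_n; gq2 : 'I_n;
                               gmat : bool * bool -> bool * bool -> C }.

Definition set2 (n : nat) (x : bits n) (i j : 'I_n) (a b : bool) : bits n :=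
  [ffun q => if q == i then a else if q == j then b else x q].

Definition apply_gate (n : nat) (g : gate n) (psi : vec (bits n)) : vec (bits n) :=
  fun x => \sum_(c : bool * bool)
      gmat g (x (gq1 g), x (gq2 g)) c * psi (set2 x (gq1 g) (gq2 g) c.1 c.2).

Definition gate_ok (n : nat) (G : rel 'I_n) (g : gate n) : Prop :=
  G (gq1 g) (gq2 g) /\ unitary2 (gmat g).

Definition layer_ok (n : nat) (G : rel 'I_n) (L : seq (gate n)) : Prop :=
  (forall g, List.In g L -> gate_ok G g) /\
  uniq (flatten [seq [:: gq1 g; gq2 g] | g <- L]).

(* the layer U_L = tensor product of its gates (they act on disjoint qubits) *)
Definition apply_layer (n : nat) (L : seq (gate n)) (psi : vec (bits n)) : vec (bits n) :=
  foldr (@apply_gate n) psi L.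

Definition zero_state (n : nat) : vec (bits n) :=
  fun x => (x == [ffun _ => false])%:R.

Definition run_circuit (n : nat) (c : seq (seq (gate n))) : vec (bits n) :=
  foldl (fun psi L => apply_layer L psi) (@zero_state n) c.

Definition has_circuit (n : nat) (G : rel 'I_n) (psi : vec (bits n)) (l : nat) : Prop :=
  exists c : seq (seq (gate n)),
    size c = l /\ (forall L, List.In L c -> layer_ok G L) /\ run_circuit c = psi.

Definition robust_complexity_gt (n : nat) (G : rel 'I_n) (delta : R)
  (psi : vec (bits n)) (r : R) : Prop :=
  forall (psi' : vec (bits n)) (l : nat),
    inner psi' psi' = 1 ->
    trnorm (op_sub (proj_op psi') (proj_op psi)) <= delta ->
    has_circuit G psi' l -> r < l%:R.

Definition log2 (x : R) : R := ln x / ln 2.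
Definition H2 (p : R) : R := - p * log2 p - (1 - p) * log2 (1 - p).

End QuantumDefs.

Definition site (D : nat) := 'I_D -> int.
Definition lattice_nn (D : nat) (a b : site D) : Prop :=
  (\sum_(i < D) `|a i - b i|)%N = 1%N.

(* G is the nearest-neighbour adjacency graph of n qubits placed on sites of
   the D-dimensional integer lattice, with arbitrary global topology: the
   qubits are the image of a set A of lattice sites under a map pos which is a
   local isomorphism of nearest-neighbour structure (open boundaries: pos
   injective on finite A; periodic boundaries: A = Z^D and pos = reduction
   modulo the periods; etc.). *)
Definition lattice_graph (D n : nat) (G : rel 'I_n) : Prop :=
  (forall i j, G i j = G j i) /\ (forall i, G i i = false) /\
  exists (A : site D -> Prop) (pos : site D -> 'I_n),
    (forall v : 'I_n, exists a, A a /\ pos a = v) /\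
    (forall a b, A a -> A b -> lattice_nn a b -> pos a != pos b ->
       G (pos a) (pos b)) /\
    (forall a (w : 'I_n), A a -> G (pos a) w ->
       exists b, [/\ A b, lattice_nn a b & pos b = w]).

(* Main.v *)
(** If [psi' = U |0>] with [U] of depth [l], then [X_i = U Z_i U^dagger] is a unitary
    supported on the ball of radius [l] around qubit [i], a connected set of at most
    [(2l+1)^D <= d] sites, and it stabilises [psi'].  Since [|tr (X A)| <= ||A||_1] for
    every contraction [X], the expectation of [X_i] in [psi] is at least [1 - delta], and
    in the maximally mixed code state [Gamma] at least [1 - delta - eps].  Measuring
    [U^dagger Gamma U] in the computational basis therefore gives a distribution [q] on bit
    strings whose one-bit marginals are at most [p = (eps + delta) / 2], while
    [q <= 2 ^- k] pointwise by Bessel's inequality.  Comparing [q] with the product of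
    Bernoulli([p]) weights yields [k <= n H2(p)]. *)

Require Import Defs.
From Stdlib Require Import ClassicalEpsilon.
From mathcomp Require Import all_boot all_order all_algebra.
From mathcomp Require Import all_classical all_reals.
From mathcomp Require Import exp.
From mathcomp Require Import complex spectral ring lra zify.
Import Order.TTheory GRing.Theory Num.Theory.
Set Implicit Arguments. Unset Strict Implicit. Unset Printing Implicit Defensive.
Local Open Scope ring_scope.

(** * Inner products, orthonormal families, Bessel's inequality *)

Section FiniteDimension.
Variables (R : realType).
Local Notation C := (R[i]).
Implicit Types (T I : finType).

Definition op_app T (A : op R T) (v : vec R T) : vec R T :=
  fun x => \sum_y A x y * v y.

Definition contraction T (X : op R T) : Prop :=
  forall v, inner (op_app X v) (op_app X v) <= inner v v.

Definition is_orthonormal I T (e : I -> vec R T) : Prop :=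
  forall i j, inner (e i) (e j) = (i == j)%:R.

(** Resolution of the identity, [sum_i |e i><e i| = 1]; traces are expanded with it. *)
Definition is_complete I T (e : I -> vec R T) : Prop :=
  forall x y, \sum_i e i x * (e i y)^* = (x == y)%:R.

Lemma sum_delta T (f : T -> C) (a : T) : \sum_x (a == x)%:R * f x = f a.
Proof.
rewrite (bigD1 a) //= eqxx mul1r big1 ?addr0 // => i.
by rewrite eq_sym => /negPf ->; rewrite mul0r.
Qed.

Lemma inner_conj T (u v : vec R T) : (inner u v)^* = inner v u.
Proof.
by rewrite /inner rmorph_sum; apply: eq_bigr => x _; rewrite rmorphM /= conjCK mulrC.
Qed.

Lemma inner_normE T (v : vec R T) : inner v v = \sum_x `|v x| ^+ 2.
Proof. by apply: eq_bigr => x _; rewrite normCK mulrC. Qed.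

Lemma inner_ge0 T (v : vec R T) : 0 <= inner v v.
Proof. by rewrite inner_normE sumr_ge0 // => x _; rewrite exprn_ge0. Qed.

Lemma inner_sumr I T (u : vec R T) (c : I -> C) (e : I -> vec R T) :
  inner u (fun x => \sum_i c i * e i x) = \sum_i c i * inner u (e i).
Proof.
rewrite /inner; under eq_bigr do rewrite mulr_sumr.
rewrite exchange_big; apply: eq_bigr => i _; rewrite mulr_sumr.
by apply: eq_bigr => x _; rewrite mulrCA.
Qed.

Lemma inner_suml I T (u : vec R T) (c : I -> C) (e : I -> vec R T) :
  inner (fun x => \sum_i c i * e i x) u = \sum_i (c i)^* * inner (e i) u.
Proof.
rewrite -inner_conj inner_sumr rmorph_sum; apply: eq_bigr => i _.
by rewrite rmorphM /= inner_conj.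
Qed.

Lemma inner_subr T (u v w : vec R T) :
  inner u (fun x => v x - w x) = inner u v - inner u w.
Proof. by rewrite /inner -sumrB; apply: eq_bigr => x _; rewrite mulrBr. Qed.

Lemma inner_subl T (u v w : vec R T) :
  inner (fun x => v x - w x) u = inner v u - inner w u.
Proof. by rewrite -inner_conj inner_subr rmorphB /= !inner_conj. Qed.

Lemma inner_orthonormal I T (e : I -> vec R T) (c : I -> C) :
  is_orthonormal e ->
  inner (fun x => \sum_i c i * e i x) (fun x => \sum_i c i * e i x) =
  \sum_i `|c i| ^+ 2.
Proof.
move=> eON; rewrite inner_sumr; apply: eq_bigr => i _; rewrite inner_suml.
under eq_bigr do rewrite eON eq_sym mulrC.
by rewrite sum_delta -normCK.
Qed.

(** The residual of [v] after projection onto the span of [e] has nonnegative square norm, and this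
    square norm is the difference of the two sides. *)
Lemma bessel I T (e : I -> vec R T) (v : vec R T) : is_orthonormal e ->
  \sum_i `|inner (e i) v| ^+ 2 <= inner v v.
Proof.
move=> eON; pose w x := \sum_i inner (e i) v * e i x.
have vw : inner v w = \sum_i `|inner (e i) v| ^+ 2.
  rewrite inner_sumr; apply: eq_bigr => i _.
  by rewrite -(inner_conj (e i) v) normCK.
have wv : inner w v = \sum_i `|inner (e i) v| ^+ 2.
  by rewrite -inner_conj vw rmorph_sum; apply: eq_bigr => i _; rewrite rmorphXn /= conj_normC.
rewrite -subr_ge0; suff -> : inner v v - \sum_i `|inner (e i) v| ^+ 2 =
  inner (fun x => v x - w x) (fun x => v x - w x) by exact: inner_ge0.
rewrite inner_subl !inner_subr vw wv.
by rewrite {2}/w inner_orthonormal // subrr subr0.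
Qed.

(** Cauchy-Schwarz against a unit vector, as Bessel's inequality for a one-element family. *)
Lemma norm_inner_unit T (e v : vec R T) : inner e e = 1 ->
  `|inner e v| ^+ 2 <= inner v v.
Proof.
move=> e1; have := @bessel unit T (fun=> e) v.
by rewrite big_const card_unit /= addr0; apply => -[] [] /=.
Qed.

(** * Operators: spectral decomposition, square roots, trace norm *)

Lemma op_appE T (A B : op R T) v x :
  op_app A (op_app B v) x = op_app (op_mul A B) v x.
Proof.
rewrite /op_app /op_mul; under eq_bigr do rewrite mulr_sumr.
rewrite exchange_big; apply: eq_bigr => y _; rewrite mulr_suml.
by apply: eq_bigr => z _; rewrite mulrA.
Qed.

Lemma inner_adj T (A : op R T) u v :
  inner (op_app A u) v = inner u (op_app (op_adj A) v).
Proof.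
rewrite /inner /op_app /op_adj; under eq_bigr do rewrite rmorph_sum mulr_suml.
rewrite exchange_big; apply: eq_bigr => x _; rewrite mulr_sumr.
by apply: eq_bigr => y _; rewrite rmorphM /= mulrCA mulrA.
Qed.

Lemma op_tr_complete I T (e : I -> vec R T) (A : op R T) : is_complete e ->
  op_tr A = \sum_i inner (e i) (op_app A (e i)).
Proof.
move=> eC; rewrite /inner /op_app /op_tr exchange_big /=.
apply: eq_bigr => x _; under eq_bigr do rewrite mulr_sumr.
rewrite exchange_big -[LHS](@sum_delta T (fun y => A x y)); apply: eq_bigr => y _ /=.
rewrite eq_sym -eC mulr_suml; apply: eq_bigr => i _.
by rewrite mulrAC mulrC [e i y * _]mulrC.
Qed.

Lemma spectral_op T (B : op R T) : op_adj B = B ->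
  exists (e : T -> vec R T) (b : T -> C), [/\ is_orthonormal e, is_complete e &
    forall x y, B x y = \sum_t b t * (e t x * (e t y)^*)].
Proof.
move=> hB; pose M : 'M[C]_#|T| := \matrix_(i, j) B (enum_val i) (enum_val j).
have sumT (f : T -> C) : \sum_x f x = \sum_(i < #|T|) f (enum_val i).
  by rewrite (reindex _ (onW_bij _ (@enum_val_bij T))).
have Mherm : M \is hermsymmx.
  apply/is_hermitianmxP; rewrite expr0 scale1r; apply/matrixP => i j.
  by rewrite !mxE -{1}hB.
have Mn := hermitian_normalmx Mherm.
have := orthomx_spectralP Mn; set P := spectralmx M; set D := spectral_diag M => ME.
have Pu : P \is unitarymx by exact: spectral_unitarymx.
rewrite (invmx_unitary Pu) in ME.
(* Since [M = P^dagger D P], the eigenvectors are the conjugated rows of [P], carried from ordinals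
   back to [T]. *)
exists (fun t x => (P (enum_rank t) (enum_rank x))^*), (fun t => D 0 (enum_rank t)).
split.
- move=> s t; rewrite /inner sumT.
  move/unitarymxP: Pu => /matrixP/(_ (enum_rank s) (enum_rank t)).
  rewrite !mxE (inj_eq enum_rank_inj) => <-; apply: eq_bigr => i _.
  by rewrite !mxE enum_valK conjCK.
- move=> x y; rewrite sumT.
  move: Pu; rewrite -trmxC_unitary => /unitarymxP/matrixP.
  move=> /(_ (enum_rank x) (enum_rank y)); rewrite trmxCK !mxE (inj_eq enum_rank_inj) => <-; apply: eq_bigr => i _.
  by rewrite !mxE enum_valK conjCK.
- move=> x y; move/matrixP: ME => /(_ (enum_rank x) (enum_rank y)).
  rewrite mxE !enum_rankK => ->; rewrite sumT !mxE; apply: eq_bigr => i _.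
  rewrite mul_mx_diag !mxE enum_valK conjCK mulrA.
  by rewrite [D 0 i * _]mulrC.
Qed.

Lemma op_app_spectral T (e : T -> vec R T) (b : T -> C) (B : op R T) t x :
  is_orthonormal e -> (forall x y, B x y = \sum_t b t * (e t x * (e t y)^*)) ->
  op_app B (e t) x = b t * e t x.
Proof.
move=> eON BE; rewrite /op_app.
transitivity (\sum_s b s * e s x * inner (e s) (e t)).
  under eq_bigr do rewrite BE mulr_suml.
  rewrite exchange_big; apply: eq_bigr => s _; rewrite /inner mulr_sumr.
  by apply: eq_bigr => y _; rewrite !mulrA.
under eq_bigr do rewrite eON eq_sym mulrC.
by rewrite (sum_delta (fun s => b s * e s x)).
Qed.

Lemma inner_op_appE T (A : op R T) (u v : vec R T) :
  inner u (op_app A v) = \sum_x \sum_y (u x)^* * A x y * v y.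
Proof.
by apply: eq_bigr => x _; rewrite mulr_sumr; apply: eq_bigr => y _; rewrite mulrA.
Qed.

Lemma inner_scaler T (u v : vec R T) c : inner u (fun x => c * v x) = c * inner u v.
Proof. by rewrite /inner mulr_sumr; apply: eq_bigr => x _; rewrite mulrCA. Qed.

Lemma spectral_psd T (B : op R T) : psd B ->
  exists (e : T -> vec R T) (b : T -> C), [/\ is_orthonormal e, is_complete e,
    forall t, 0 <= b t & forall x y, B x y = \sum_t b t * (e t x * (e t y)^*)].
Proof.
move=> [hB pB]; have [e [b [eON eC BE]]] := spectral_op hB.
exists e, b; split => // t; have := pB (e t); rewrite -inner_op_appE.
have -> : op_app B (e t) = fun x => b t * e t x.
  by apply/funext => x; rewrite (op_app_spectral _ _ eON BE).
by rewrite inner_scaler eON eqxx mulr1.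
Qed.

Lemma op_mul_spectral T (e : T -> vec R T) (b c : T -> C) (A B : op R T) x y :
  is_orthonormal e -> (forall x y, A x y = \sum_t b t * (e t x * (e t y)^*)) ->
  (forall x y, B x y = \sum_t c t * (e t x * (e t y)^*)) ->
  op_mul A B x y = \sum_t b t * c t * (e t x * (e t y)^*).
Proof.
move=> eON AE BE; rewrite /op_mul.
transitivity (\sum_t op_app A (e t) x * (c t * (e t y)^*)).
  under eq_bigr do rewrite BE mulr_sumr.
  rewrite exchange_big; apply: eq_bigr => t _; rewrite /op_app mulr_suml.
  by apply: eq_bigr => z _; rewrite -!mulrA [c t * _]mulrCA.
by apply: eq_bigr => t _; rewrite (op_app_spectral _ _ eON AE); ring.
Qed.

Lemma psd_spectral T (e : T -> vec R T) (b : T -> C) : (forall t, 0 <= b t) ->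
  psd (fun x y => \sum_t b t * (e t x * (e t y)^*)).
Proof.
move=> b0; split.
  apply/funext => x; apply/funext => y; rewrite /op_adj rmorph_sum.
  apply: eq_bigr => t _; rewrite !rmorphM /= conjCK (geC0_conj (b0 t)).
  by rewrite [_^* * _]mulrC.
move=> v; rewrite -inner_op_appE; set w := op_app _ v.
have -> : w = fun x => \sum_t (b t * inner (e t) v) * e t x.
  apply/funext => x; rewrite /w /op_app; under eq_bigr do rewrite mulr_suml.
  rewrite exchange_big; apply: eq_bigr => t _; rewrite /inner -mulrA mulr_suml mulr_sumr.
  by apply: eq_bigr => y _; ring.
rewrite inner_sumr sumr_ge0 // => t _; rewrite -(inner_conj (e t) v) -mulrA -normCK.
by rewrite mulr_ge0 // exprn_ge0.
Qed.

(** Take square roots of the eigenvalues. As [op_sqrt] is an epsilon choice, exhibiting one positive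
    root is what gives access to its specification. *)
Lemma psd_sqrt_exists T (M : op R T) : psd M ->
  exists B : op R T, psd B /\ op_mul B B = M.
Proof.
move=> /spectral_psd[e [b [eON eC b0 ME]]].
exists (fun x y => \sum_t sqrtC (b t) * (e t x * (e t y)^*)); split.
  by apply: psd_spectral => t; rewrite sqrtC_ge0.
apply/funext => x; apply/funext => y.
rewrite (@op_mul_spectral _ e (fun t => sqrtC (b t)) (fun t => sqrtC (b t))) //.
by rewrite ME; apply: eq_bigr => t _; rewrite -expr2 sqrtCK.
Qed.

Lemma inner_gram T (A : op R T) u v :
  inner (op_app A u) (op_app A v) = inner u (op_app (op_mul (op_adj A) A) v).
Proof. by rewrite inner_adj; congr inner; apply/funext => x; rewrite op_appE. Qed.

Lemma psd_gram T (A : op R T) : psd (op_mul (op_adj A) A).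
Proof.
split; last by move=> v; rewrite -inner_op_appE -inner_gram inner_ge0.
apply/funext => x; apply/funext => y; rewrite /op_adj /op_mul rmorph_sum.
by apply: eq_bigr => z _; rewrite rmorphM /= conjCK mulrC.
Qed.

Lemma op_sqrtP T (M : op R T) : psd M -> psd (op_sqrt M) /\ op_mul (op_sqrt M) (op_sqrt M) = M.
Proof. by move=> /psd_sqrt_exists; apply: epsilon_spec. Qed.

(* The eigenvalues of [|A|] are the lengths of the images under [A] of its eigenvectors. *)
Lemma trnorm_spectral T (A : op R T) :
  exists (e : T -> vec R T) (b : T -> C), [/\ is_orthonormal e, is_complete e,
    forall t, 0 <= b t, forall t, inner (op_app A (e t)) (op_app A (e t)) = b t ^+ 2 &
    (trnorm A)%:C%C = \sum_t b t].
Proof.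
have [Bpsd BB] := op_sqrtP (psd_gram A); rewrite /trnorm.
set B := op_sqrt _ in Bpsd BB *.
have [e [b [eON eC b0 BE]]] := spectral_psd Bpsd.
have appB t : op_app B (e t) = fun x => b t * e t x.
  by apply/funext => x; rewrite (op_app_spectral _ _ eON BE).
exists e, b; split => //.
  move=> t; rewrite inner_gram -BB.
  have -> : op_app (op_mul B B) (e t) = fun x => b t * (b t * e t x).
    apply/funext => x; rewrite -op_appE appB /op_app.
    transitivity (b t * op_app B (e t) x); last by rewrite appB.
    by rewrite /op_app mulr_sumr; apply: eq_bigr => y _; rewrite mulrCA.
  by rewrite !inner_scaler eON eqxx mulr1.
have trB : op_tr B = \sum_t b t.
  rewrite (op_tr_complete _ eC); apply: eq_bigr => t _.
  by rewrite appB inner_scaler eON eqxx mulr1.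
rewrite trB RRe_real // ger0_real // sumr_ge0 // => t _; exact: b0.
Qed.

(** Expand the trace in the eigenbasis of [|A|]: each diagonal term [<e t, X A e t>] has modulus at
    most the length of [A (e t)], which is the eigenvalue [b t]. *)
Lemma trace_le_trnorm T (X A : op R T) : contraction X ->
  `|op_tr (op_mul X A)| <= (trnorm A)%:C%C.
Proof.
move=> Xc; have [e [b [eON eC b0 bA ->]]] := trnorm_spectral A.
rewrite (op_tr_complete _ eC); apply: le_trans (ler_norm_sum _ _ _) _.
apply: ler_sum => t _.
have -> : op_app (op_mul X A) (e t) = op_app X (op_app A (e t)).
  by apply/funext => x; rewrite op_appE.
rewrite -(@ler_pXn2r _ 2%N) ?nnegrE ?b0 //.
apply: le_trans (norm_inner_unit _ _) _; first by rewrite eON eqxx.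
by rewrite -bA; apply: Xc.
Qed.

(** Each eigenvalue of [|A|] satisfies [b <= 1 + b ^ 2], and the squares add up to the squared
    Hilbert-Schmidt norm. This crude bound serves to show that the supremum in the subsystem
    variance is finite. *)
Lemma trnorm_le T (A : op R T) :
  (trnorm A)%:C%C <= #|T|%:R + \sum_x \sum_y `|A x y| ^+ 2.
Proof.
have [e [b [eON eC b0 bA ->]]] := trnorm_spectral A.
have -> : \sum_x \sum_y `|A x y| ^+ 2 = \sum_t b t ^+ 2.
  transitivity (op_tr (op_mul (op_adj A) A)).
    rewrite exchange_big; apply: eq_bigr => x _; apply: eq_bigr => y _.
    by rewrite normCK mulrC.
  by rewrite (op_tr_complete _ eC); apply: eq_bigr => t _; rewrite -inner_gram bA.
have -> : #|T|%:R = \sum_(t : T) (1 : C) by rewrite sumr_const.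
rewrite -big_split; apply: ler_sum => t _ /=.
have /real_leVge/(_ (real1 _))/orP[b1|b1] : b t \is Num.real by rewrite ger0_real.
  by rewrite (le_trans b1) // lerDl exprn_ge0.
by apply: le_trans (_ : b t ^+ 2 <= _); rewrite ?lerDr // expr2 ler_peMl.
Qed.

End FiniteDimension.

(** * Operators acting as the identity on a qubit *)

Section Locality.
Variables (R : realType) (n : nat).
Local Notation C := (R[i]).
Implicit Types (x y : bits n) (g : gate R n) (K : op R (bits n)) (j : 'I_n).

Definition set_bit x j (a : bool) : bits n := [ffun q => if q == j then a else x q].

(* [K] acts as the identity on qubit [j]. *)
Definition trivial_at j K : Prop := forall x y a b,
  K (set_bit x j a) (set_bit y j b) = (a == b)%:R * K (set_bit x j false) (set_bit y j false).

Lemma set_bit_id x j : set_bit x j (x j) = x.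
Proof. by apply/ffunP => q; rewrite ffunE; case: eqP => // ->. Qed.

Lemma trivial_at_eq0 j K x y : trivial_at j K -> x j != y j -> K x y = 0.
Proof.
by move=> tK /negPf xy; rewrite -(set_bit_id x j) -(set_bit_id y j) tK xy mul0r.
Qed.

Lemma trivial_at_set_bit j K x y : trivial_at j K -> x j = y j ->
  K (set_bit x j false) (set_bit y j false) = K x y.
Proof.
by move=> tK xy; rewrite -[in RHS](set_bit_id x j) -[in RHS](set_bit_id y j) [RHS]tK xy eqxx mul1r.
Qed.

(** The qubits are cleared one at a time. With [s] listing the complement of a set [S], this
    recovers [K] from its block on [S]. *)
Lemma trivial_at_clear (s : seq 'I_n) K x y :
  (forall j, j \in s -> trivial_at j K) -> (forall j, j \in s -> x j = y j) ->
  K [ffun q => if q \in s then false else x q]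
    [ffun q => if q \in s then false else y q] = K x y.
Proof.
elim: s => [|j s IHs] tK xy.
  by congr K; apply/ffunP => q; rewrite ffunE.
have tKs i : i \in s -> trivial_at i K by move=> si; apply: tK; rewrite inE si orbT.
have xys i : i \in s -> x i = y i by move=> si; apply: xy; rewrite inE si orbT.
rewrite -(IHs tKs xys).
have tj : trivial_at j K by apply: tK; rewrite inE eqxx.
rewrite -[RHS](trivial_at_set_bit tj); last first.
  by rewrite !ffunE xy // inE eqxx.
by congr K; apply/ffunP => q; rewrite !ffunE inE; case: (q == j).
Qed.

(** * Local operators and the partial trace *)

Section Reduction.
Variable S : {set 'I_n}.

Definition extend0 (b : sbits S) : bits n := @override n S b [ffun=> false].

(** For [K] acting trivially off [S] this is the factor [K_S] of [K = K_S (x) 1], read off the block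
    where all outside bits are false. *)
Definition compress K : op R (sbits S) := fun a b => K (extend0 a) (extend0 b).

Lemma overrideK (x : bits n) : cancel (fun b => @override n S b x) (@restr n S).
Proof.
move=> b; apply/ffunP => -[q qS]; rewrite !ffunE /=.
by rewrite insubT /=; congr (b _); apply/val_inj.
Qed.

Lemma override_in (b : sbits S) x q (qS : q \in S) : @override n S b x q = b (Sub q qS).
Proof. by rewrite ffunE insubT. Qed.

Lemma override_out (b : sbits S) x q : q \notin S -> @override n S b x q = x q.
Proof. by move=> qS; rewrite ffunE insubF // (negPf qS). Qed.

Lemma override_restr x y :
  (y == @override n S (@restr n S y) x) = [forall q in ~: S, y q == x q].
Proof.
apply/eqP/forall_inP => [-> q|H].
  by rewrite inE => qS; rewrite override_out.
apply/ffunP => q; case: (boolP (q \in S)) => qS.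
  by rewrite override_in ffunE.
by rewrite override_out //; apply/eqP/H; rewrite inE.
Qed.

Lemma compress_trivial K x y : (forall j, j \notin S -> trivial_at j K) ->
  (forall j, j \notin S -> x j = y j) ->
  compress K (@restr n S x) (@restr n S y) = K x y.
Proof.
move=> tK xy; rewrite -(@trivial_at_clear (enum (~: S)) K x y); last first.
- by move=> j; rewrite mem_enum inE => /xy.
- by move=> j; rewrite mem_enum inE => /tK.
rewrite /compress /extend0; congr K; apply/ffunP => q; rewrite [RHS]ffunE mem_enum inE;
  (case: (boolP (q \in S)) => qS; last by rewrite override_out // ffunE);
  by rewrite override_in ffunE.
Qed.

(** The duality characterising the partial trace, [tr (K_S rho_S) = tr (K rho)]: expectations of
    local observables depend on the reduced state alone. *)
Lemma op_tr_ptrace K rho : (forall j, j \notin S -> trivial_at j K) ->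
  op_tr (op_mul (compress K) (@ptrace R n S rho)) = op_tr (op_mul K rho).
Proof.
move=> tK; rewrite /op_tr /op_mul.
transitivity (\sum_b \sum_x compress K b (@restr n S x) * rho x (@override n S b x)).
  apply: eq_bigr => b _; rewrite /ptrace.
  rewrite (partition_big (@restr n S) xpredT) //=; apply: eq_bigr => a _.
  by rewrite mulr_sumr; apply: eq_bigr => x /eqP <-.
rewrite exchange_big [RHS]exchange_big; apply: eq_bigr => x _ /=.
(* Only the [y] that agree with [x] outside [S] contribute; they are parametrised by their bits on
   [S]. *)
rewrite [RHS](bigID (fun y => y == @override n S (@restr n S y) x)) /=.
rewrite [X in _ = _ + X]big1 ?addr0.
  rewrite (reindex_onto (fun b => @override n S b x) (@restr n S)) /=; last first.
    by move=> y /eqP <-.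
  apply: eq_big => [b|b _]; first by rewrite !overrideK !eqxx.
  rewrite -[K _ x]compress_trivial //; first by rewrite overrideK.
  by move=> j jS; rewrite override_out.
move=> y; rewrite override_restr negb_forall => /existsP[q].
rewrite negb_imply inE => /andP[qS yx].
by rewrite (trivial_at_eq0 (tK _ qS)) // mul0r.
Qed.

(** [compress K] is [V^dagger K V], where the isometry [V] pads a vector with zeros ([v] below) and
    [V^dagger] drops components, so lengths do not grow. *)
Lemma contraction_compress K : contraction K -> contraction (compress K).
Proof.
move=> cK w; pose v x := if x == extend0 (@restr n S x) then w (@restr n S x) else 0.
have sumv (F : bits n -> C) : \sum_(x | x == extend0 (@restr n S x)) F x =
    \sum_b F (extend0 b).
  rewrite (reindex_onto extend0 (@restr n S)) /=; last by move=> x /eqP <-.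
  by apply: eq_bigl => b; rewrite !overrideK !eqxx.
have vE b : v (extend0 b) = w b by rewrite /v !overrideK eqxx.
have appE b : op_app (compress K) w b = op_app K v (extend0 b).
  rewrite /op_app [RHS](bigID (fun x => x == extend0 (@restr n S x))) /=.
  rewrite [X in _ = _ + X]big1 ?addr0; last first.
    by move=> y /negPf; rewrite /v => ->; rewrite mulr0.
  by rewrite sumv; apply: eq_bigr => a _; rewrite vE.
have -> : inner w w = inner v v.
  rewrite !inner_normE [RHS](bigID (fun x => x == extend0 (@restr n S x))) /=.
  rewrite [X in _ = _ + X]big1 ?addr0; last first.
    by move=> y /negPf; rewrite /v => ->; rewrite normr0 expr0n.
  by rewrite sumv; apply: eq_bigr => a _; rewrite vE.
apply: le_trans (cK v); rewrite !inner_normE.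
rewrite [leRHS](bigID (fun x => x == extend0 (@restr n S x))) /= sumv.
under eq_bigr do rewrite appE.
by rewrite lerDl sumr_ge0 // => x _; rewrite exprn_ge0.
Qed.

End Reduction.

(** * Conjugation by two-qubit gates *)

Definition gate_bits g x := (x (gq1 g), x (gq2 g)).
Definition gate_set g x (c : bool * bool) := set2 x (gq1 g) (gq2 g) c.1 c.2.

(* The kernel of [U_g K U_g^dagger]. *)
Definition conj_gate g K : op R (bits n) := fun x y =>
  \sum_c \sum_c' gmat g (gate_bits g x) c * (gmat g (gate_bits g y) c')^* *
    K (gate_set g x c) (gate_set g y c').

(** A left inverse of a square matrix is also a right inverse, so the rows are orthonormal along
    with the columns. *)
Lemma unitary2_right (u : bool * bool -> bool * bool -> C) : unitary2 u ->
  forall a b, \sum_c u a c * (u b c)^* = (a == b)%:R.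
Proof.
move=> uu a b; pose N := #|{: bool * bool}|.
have sumT (f : bool * bool -> C) : \sum_x f x = \sum_(i < N) f (enum_val i).
  by rewrite (reindex _ (onW_bij _ (@enum_val_bij _))).
pose M : 'M[C]_N := \matrix_(i, k) u (enum_val i) (enum_val k).
pose M' : 'M[C]_N := \matrix_(i, k) (u (enum_val k) (enum_val i))^*.
have : M' *m M = 1%:M.
  apply/matrixP => i k; rewrite !mxE -(inj_eq enum_val_inj) -uu sumT.
  by apply: eq_bigr => c _; rewrite !mxE.
move/mulmx1C/matrixP/(_ (enum_rank a) (enum_rank b)).
rewrite !mxE (inj_eq enum_rank_inj) => <-; rewrite sumT.
by apply: eq_bigr => c _; rewrite !mxE !enum_rankK.
Qed.

Section Gate.
Variable g : gate R n.
Hypotheses (gneq : gq1 g != gq2 g) (gU : unitary2 (gmat g)).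

Lemma gate_bits_set x c : gate_bits g (gate_set g x c) = c.
Proof.
by case: c => a b; rewrite /gate_bits !ffunE !eqxx [gq2 g == _]eq_sym (negPf gneq).
Qed.

Lemma gate_set_set x c c' : gate_set g (gate_set g x c) c' = gate_set g x c'.
Proof.
by apply/ffunP => q; rewrite !ffunE; case: (q == gq1 g); case: (q == gq2 g).
Qed.

Lemma gate_set_bits x : gate_set g x (gate_bits g x) = x.
Proof. by apply/ffunP => q; rewrite !ffunE; case: eqP => [->|_] //; case: eqP => [->|]. Qed.

Lemma inner_apply_gate u v : inner (apply_gate g u) (apply_gate g v) = inner u v.
Proof.
pose F (p : bits n * (bool * bool)) : C := \sum_c' (gmat g (gate_bits g p.1) p.2)^* *
  (u (gate_set g p.1 p.2))^* * (gmat g (gate_bits g p.1) c' * v (gate_set g p.1 c')).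
transitivity (\sum_p F p).
  rewrite -(pair_big xpredT xpredT (fun x c => F (x, c))) /=; apply: eq_bigr => x _.
  rewrite /apply_gate rmorph_sum mulr_suml; apply: eq_bigr => c _.
  by rewrite rmorphM mulr_sumr.
(* [h] is an involution exchanging the two gate bits of the string with the summation index. After
   it the sum over [a] runs over a column product of the gate matrix, where unitarity applies. *)
pose h (p : bits n * (bool * bool)) := (gate_set g p.1 p.2, gate_bits g p.1).
rewrite (reindex h) /=; last first.
  apply/onW_bij/inv_bij => -[x c]; rewrite /h /=.
  by rewrite gate_set_set gate_set_bits gate_bits_set.
rewrite -(pair_big xpredT xpredT (fun y a => F (h (y, a)))) /=; apply: eq_bigr => y _.
rewrite /F /h /=.
under eq_bigr => a _ do under eq_bigr => c _ do
  rewrite gate_bits_set gate_set_set gate_set_bits gate_set_set.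
rewrite exchange_big /=.
transitivity (\sum_c (gate_bits g y == c)%:R * ((u y)^* * v (gate_set g y c))).
  apply: eq_bigr => c _; rewrite -gU mulr_suml; apply: eq_bigr => a _; ring.
by rewrite (sum_delta (fun c => (u y)^* * v (gate_set g y c))) gate_set_bits.
Qed.

Lemma trivial_at_conj_gate j K : j != gq1 g -> j != gq2 g ->
  trivial_at j K -> trivial_at j (conj_gate g K).
Proof.
move=> j1 j2 tK x y a b; rewrite /conj_gate.
have bitsE z c : gate_bits g (set_bit z j c) = gate_bits g z.
  by rewrite /gate_bits !ffunE ![_ == j]eq_sym (negPf j1) (negPf j2).
have setE z c d : gate_set g (set_bit z j c) d = set_bit (gate_set g z d) j c.
  apply/ffunP => q; rewrite !ffunE; case: (q =P j) => // ->.
  by rewrite (negPf j1) (negPf j2).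
rewrite mulr_sumr; apply: eq_bigr => c _; rewrite mulr_sumr; apply: eq_bigr => c' _.
by rewrite !bitsE !setE tK; ring.
Qed.

Lemma trivial_at_gate_set K x y c c' : trivial_at (gq1 g) K -> trivial_at (gq2 g) K ->
  K (gate_set g x c) (gate_set g y c') =
  (c == c')%:R * K (gate_set g x (false, false)) (gate_set g y (false, false)).
Proof.
move=> t1 t2; have setE z d : gate_set g z d = set_bit (set_bit z (gq2 g) d.2) (gq1 g) d.1.
  by apply/ffunP => q; rewrite !ffunE.
have setC z a b : set_bit (set_bit z (gq2 g) b) (gq1 g) a = set_bit (set_bit z (gq1 g) a) (gq2 g) b.
  apply/ffunP => q; rewrite !ffunE; case: (q =P gq1 g) => // ->.
  by rewrite (negPf gneq).
rewrite !setE t1 !setC t2 /= -!setC mulrA -natrM mulnb.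
by case: c c' => a b [a' b'].
Qed.

(** [K] commutes with the gate, so [U K U^dagger = K U U^dagger = K]. *)
Lemma conj_gate_id K : trivial_at (gq1 g) K -> trivial_at (gq2 g) K ->
  conj_gate g K = K.
Proof.
move=> t1 t2; apply/funext => x; apply/funext => y; rewrite /conj_gate.
set k := K (gate_set g x (false, false)) (gate_set g y (false, false)).
transitivity ((gate_bits g x == gate_bits g y)%:R * k); last first.
  by rewrite -[in RHS](gate_set_bits x) -[in RHS](gate_set_bits y) trivial_at_gate_set.
rewrite -(unitary2_right gU) mulr_suml; apply: eq_bigr => c _.
transitivity (\sum_c' (c == c')%:R *
   (gmat g (gate_bits g x) c * (gmat g (gate_bits g y) c')^* * k)).
  by apply: eq_bigr => c' _; rewrite trivial_at_gate_set // -/k; ring.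
by rewrite (sum_delta (fun c' => gmat g (gate_bits g x) c * (gmat g (gate_bits g y) c')^* * k)).
Qed.

End Gate.

(** The operator [sum_t s t |v t><v t|]. Conjugation by a gate keeps this shape and only moves the
    vectors, which links the evolution of operators to that of states. *)
Definition spectral_sum (I : finType) (s : I -> C) (v : I -> vec R (bits n)) : op R (bits n) :=
  fun x y => \sum_t s t * (v t x * (v t y)^*).

Lemma conj_gate_sum (I : finType) g (s : I -> C) (v : I -> vec R (bits n)) :
  conj_gate g (spectral_sum s v) = spectral_sum s (fun t => apply_gate g (v t)).
Proof.
apply/funext => x; apply/funext => y; rewrite /conj_gate /spectral_sum.
under eq_bigr => c _ do under eq_bigr => c' _ do rewrite mulr_sumr.
under eq_bigr => c _ do rewrite exchange_big /=.
rewrite exchange_big; apply: eq_bigr => t _ /=.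
rewrite /apply_gate rmorph_sum mulr_suml mulr_sumr; apply: eq_bigr => c _.
rewrite !mulr_sumr; apply: eq_bigr => c' _.
by rewrite rmorphM /= /gate_set /gate_bits; ring.
Qed.

Definition run (c : seq (seq (gate R n))) (v : vec R (bits n)) : vec R (bits n) :=
  foldl (fun psi L => apply_layer L psi) v c.

Definition conj_layer (L : seq (gate R n)) K := foldr conj_gate K L.

Definition conj_circuit (c : seq (seq (gate R n))) K :=
  foldl (fun K L => conj_layer L K) K c.

Lemma conj_layer_sum (I : finType) L (s : I -> C) (v : I -> vec R (bits n)) :
  conj_layer L (spectral_sum s v) = spectral_sum s (fun t => apply_layer L (v t)).
Proof. by elim: L => //= g L ->; rewrite conj_gate_sum. Qed.

Lemma conj_circuit_sum (I : finType) c (s : I -> C) (v : I -> vec R (bits n)) :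
  conj_circuit c (spectral_sum s v) = spectral_sum s (fun t => run c (v t)).
Proof.
by rewrite /conj_circuit /run; elim: c v => //= L c IH v; rewrite conj_layer_sum IH.
Qed.

(** * Unitarity and light cones of circuits *)

Section Circuit.
Variable G : rel 'I_n.
Hypothesis Girr : forall i, G i i = false.

Lemma gate_ok_neq g : gate_ok G g -> gq1 g != gq2 g.
Proof. by case=> Gg _; apply/eqP => E; rewrite E Girr in Gg. Qed.

Lemma inner_apply_layer L u v : (forall g, List.In g L -> gate_ok G g) ->
  inner (apply_layer L u) (apply_layer L v) = inner u v.
Proof.
elim: L => //= g L IH ok; have okg : gate_ok G g by apply: ok; left.
rewrite (inner_apply_gate (gate_ok_neq okg) (proj2 okg)) IH // => h hL.
by apply: ok; right.
Qed.

Lemma inner_run c u v : (forall L, List.In L c -> layer_ok G L) ->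
  inner (run c u) (run c v) = inner u v.
Proof.
rewrite /run; elim: c u v => //= L c IH u v ok; rewrite IH; last by move=> M ?; apply: ok; right.
by apply: inner_apply_layer; apply: (proj1 (ok L _)); left.
Qed.

(** Such a [K] is a multiple of the identity, so every gate cancels against its adjoint. For [K = 1]
    this says [U U^dagger = 1]. *)
Lemma conj_circuit_trivial c K : (forall L, List.In L c -> layer_ok G L) ->
  (forall j, trivial_at j K) -> conj_circuit c K = K.
Proof.
move=> ok tK; rewrite /conj_circuit; elim: c ok => //= L c IH ok.
suff -> : conj_layer L K = K by apply: IH => M ?; apply: ok; right.
have [{}ok _] : layer_ok G L by apply: ok; left.
elim: L ok => //= g L IHL ok; have okg : gate_ok G g by apply: ok; left.
rewrite IHL; last by move=> h ?; apply: ok; right.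
apply: conj_gate_id => //; [exact: gate_ok_neq | by case: okg].
Qed.

(* Gates of one layer act on disjoint pairs, so a qubit can enter the support of [K]
   only through its own partner. *)
Lemma trivial_at_conj_layer L K j : layer_ok G L -> trivial_at j K ->
  (forall i, G i j || G j i -> trivial_at i K) -> trivial_at j (conj_layer L K).
Proof.
move=> [ok uL] tj tnb.
(* The condition on graph neighbours is weakened to one on gate partners, a form that passes to the
   tail of the layer. *)
have {tnb} : forall g, List.In g L ->
    (gq1 g = j -> trivial_at (gq2 g) K) /\ (gq2 g = j -> trivial_at (gq1 g) K).
  by move=> g /ok[Gg _]; split => E; apply: tnb; rewrite -E Gg ?orbT.
elim: L j ok uL tj => //= g L IH j ok /and3P[].
rewrite inE negb_or => /andP[n12 n1L] n2L uL tj tnb.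
have okg : gate_ok G g by apply: ok; left.
have okL h : List.In h L -> gate_ok G h by move=> ?; apply: ok; right.
(* A qubit touched by no remaining gate meets the partner condition vacuously. *)
have notin q : q \notin flatten [seq [:: gq1 h; gq2 h] | h <- L] ->
    trivial_at q K -> trivial_at q (conj_layer L K).
  move=> qL tq; apply: IH => // h; elim: (L) qL => //= h' L' IHL.
  rewrite !inE !negb_or => /and3P[q1 q2 qL] [<-|/IHL]; last exact.
  by split => E; rewrite E eqxx in q1 q2.
(* If [j] belongs to the outermost gate [g], disjointness keeps both qubits of [g] out of the other
   gates; the operator is still trivial on both, and [g] cancels. *)
have [E1|j1] := eqVneq j (gq1 g).
  have t1 : trivial_at (gq1 g) K by rewrite -E1.
  have t2 : trivial_at (gq2 g) K by apply: (proj1 (tnb g _)); [left|].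
  by rewrite (conj_gate_id n12 (proj2 okg)) ?E1; apply: notin.
have [E2|j2] := eqVneq j (gq2 g).
  have t2 : trivial_at (gq2 g) K by rewrite -E2.
  have t1 : trivial_at (gq1 g) K by apply: (proj2 (tnb g _)); [left|].
  by rewrite (conj_gate_id n12 (proj2 okg)) ?E2; apply: notin.
apply: trivial_at_conj_gate => //; apply: IH => // h hL; apply: tnb; right.
by [].
Qed.

Fixpoint ball (i : 'I_n) (t : nat) : {set 'I_n} :=
  if t is t'.+1 then ball i t' :|: [set w | [exists v in ball i t', G v w]] else [set i].

(** Each layer enlarges the support by at most one step in the graph. The induction removes the last
    layer, which is the outermost conjugation. *)
Lemma trivial_at_conj_circuit i c K (Gsym : forall i j, G i j = G j i) :
  (forall L, List.In L c -> layer_ok G L) -> (forall j, j != i -> trivial_at j K) ->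
  forall j, j \notin ball i (size c) -> trivial_at j (conj_circuit c K).
Proof.
move=> ok tK; rewrite /conj_circuit; elim/last_ind: c ok => [|c L IH] ok j.
  by rewrite inE => /tK.
rewrite size_rcons foldl_rcons /= !inE negb_or => /andP[jc /existsPn jn].
have okc M : List.In M c -> layer_ok G M.
  by move=> Mc; apply: ok; rewrite -cats1; apply/List.in_or_app; left.
apply: trivial_at_conj_layer; last 1 first.
- move=> v Gv; apply: IH => //; apply/negP => vb; have := jn v; rewrite vb /=.
  by move: Gv; rewrite (Gsym j) orbb => ->.
- by apply: ok; rewrite -cats1; apply/List.in_or_app; right; left.
exact: IH.
Qed.

End Circuit.

(** * Operators diagonal in the computational basis *)

Definition ket (t : bits n) : vec R (bits n) := fun x => (x == t)%:R.

Lemma orthonormal_ket : is_orthonormal ket.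
Proof.
move=> s t; rewrite /inner /ket -(sum_delta (fun x => (x == t)%:R)).
by apply: eq_bigr => x _; rewrite rmorph_nat eq_sym.
Qed.

Lemma spectral_sum_ket (s : bits n -> C) x y :
  spectral_sum s ket x y = (x == y)%:R * s x.
Proof.
rewrite /spectral_sum /ket -(sum_delta (fun t => (t == y)%:R * s t)).
by apply: eq_bigr => t _; rewrite rmorph_nat [y == t]eq_sym; ring.
Qed.

Lemma trivial_at_spectral_sum_ket j (s : bits n -> C) :
  (forall x a, s (set_bit x j a) = s x) -> trivial_at j (spectral_sum s ket).
Proof.
move=> sj x y a b; rewrite !spectral_sum_ket !sj mulrA -natrM mulnb.
suff -> : (set_bit x j a == set_bit y j b) = (a == b) && (set_bit x j false == set_bit y j false) by [].
apply/eqP/andP => [E|[/eqP -> /eqP E]].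
  split; first by move/ffunP/(_ j): E; rewrite !ffunE eqxx => ->.
  apply/eqP/ffunP => q; move/ffunP/(_ q): E; rewrite !ffunE.
  by case: (q == j).
by apply/ffunP => q; move/ffunP/(_ q): E; rewrite !ffunE; case: (q == j).
Qed.

End Locality.

(** * Balls in lattice graphs *)

Section Lattice.
Variables (n : nat) (G : rel 'I_n).
Hypothesis Gsym : forall i j, G i j = G j i.

(** Every point is joined to the centre by a path inside the ball, and edges are symmetric.
    Connectedness makes the ball an admissible set for the subsystem variance. *)
Lemma ball_connected i t : connected_in G (ball G i t).
Proof.
pose e t := [rel a b | [&& G a b, a \in ball G i t & b \in ball G i t]].
have esym t' : connect_sym (e t').
  by apply: sym_connect_sym => a b /=; rewrite Gsym [X in _ && X]andbC.
suff H w : w \in ball G i t -> connect (e t) i w.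
  apply/forall_inP => x /H xb; apply/forall_inP => y /H yb.
  by apply: connect_trans yb; rewrite -[X in is_true X]/(connect (e t) x i) esym.
elim: t w => [|t IH] w; first by rewrite inE => /eqP ->.
have emono : subrel (connect (e t)) (connect (e t.+1)).
  apply: connect_sub => a b /= /and3P[Gab ab bb]; apply: connect1 => /=.
  by rewrite Gab !inE ab bb.
rewrite !inE => /orP[/IH/emono //|/existsP[v /andP[vb Gvw]]].
apply: connect_trans (emono _ _ (IH _ vb)) (connect1 _) => /=.
rewrite Gvw !inE vb /=; apply/orP; right; apply/existsP; exists v.
by rewrite vb.
Qed.

(** Paths from [i] lift to lattice paths from a preimage [a], so the ball is covered by the image of
    the cube of side [2 t + 1] centred at [a]. *)
Lemma card_ball D i t : lattice_graph D G -> (#|ball G i t| <= (2 * t + 1) ^ D)%N.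
Proof.
move=> [_ [_ [A [pos [surj [_ lift]]]]]]; have [a [Aa posa]] := surj i.
have near w : w \in ball G i t -> exists b, [/\ A b, pos b = w &
    (\sum_(k < D) absz (a k - b k)%R <= t)%N].
  elim: t w => [|t IH] w.
    rewrite inE => /eqP ->; exists a; split => //.
    by rewrite big1 // => k _; rewrite subrr.
  rewrite !inE => /orP[/IH[b [Ab pb bt]]|/existsP[v /andP[/IH[b [Ab pb bt]] Gvw]]].
    by exists b; split => //; lia.
  have [b' [Ab' bb' pb']] : exists b', [/\ A b', lattice_nn b b' & pos b' = w].
    by apply: lift => //; rewrite pb.
  exists b'; split => //; rewrite /lattice_nn in bb'.
  apply: (@leq_trans (\sum_(k < D) (absz (a k - b k)%R + absz (b k - b' k)%R))).
    by apply: leq_sum => k _; lia.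
  by rewrite big_split /= bb' addn1 ltnS.
(* Coordinates of [h] are offsets from [a] shifted by [t], hence in [0 .. 2 t]. As [pos] is total,
   cube points outside [A] also have images, which can only enlarge the cover. *)
pose f (h : {ffun 'I_D -> 'I_(2 * t + 1)}) := pos (fun k => a k - t%:Z + (h k : nat)%:Z).
apply: leq_trans (_ : #|codom f| <= _)%N; last first.
  by rewrite (leq_trans (leq_image_card _ _)) // card_ffun !card_ord.
apply: subset_leq_card; apply/fintype.subsetP => w /near[b [_ <- bt]].
have bk k : (absz (a k - b k)%R <= t)%N.
  by apply: leq_trans bt; rewrite (bigD1 k) //= leq_addr.
have hk k : (absz (b k - a k + t%:Z)%R < 2 * t + 1)%N by have := bk k; lia.
apply/codomP; exists [ffun k => Ordinal (hk k)]; rewrite /f; congr pos.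
by apply/funext => k; rewrite ffunE /=; have := bk k; lia.
Qed.

End Lattice.

(** * Entropy bound from one-bit marginals *)

Section Entropy.
Variables (R : realType) (n k : nat).
Variables (q : bits n -> R) (p : R).
Hypotheses (q0 : forall x, 0 <= q x) (q1 : \sum_x q x = 1).
Hypothesis qmax : forall x, q x * (2 ^ k)%:R <= 1.
Hypothesis marginal : forall i : 'I_n, \sum_(x : bits n | x i) q x <= p.

Lemma ln_prodr (I : finType) (f : I -> R) : (forall i, 0 < f i) ->
  ln (\prod_i f i) = \sum_i ln (f i).
Proof.
move=> f0; suff [] : 0 < \prod_i f i /\ ln (\prod_i f i) = \sum_i ln (f i) by [].
apply: (big_rec2 (fun a b => 0 < a /\ ln a = b)); first by rewrite ln1.
by move=> i a b _ [b0 <-]; rewrite mulr_gt0 // lnM // posrE.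
Qed.

(* Gibbs' inequality against the product of Bernoulli(p) weights; only the bound
   [q <= 2 ^- k] on the distribution is used, so no logarithm of [q] appears. *)
Lemma bernoulli_entropy_bound : 0 < p -> p <= 1 / 2 ->
  k%:R * ln 2 <= n%:R * (- p * ln p - (1 - p) * ln (1 - p)).
Proof.
move=> p0 p2; pose w (b : bool) : R := if b then p else 1 - p.
have w0 b : 0 < w b by case: b => /=; lra.
pose r (x : bits n) := \prod_i w (x i).
have r0 x : 0 < r x by apply: prodr_gt0.
have r1 : \sum_x r x = 1.
  rewrite /r -(bigA_distr_bigA (fun (_ : 'I_n) b => w b)) big1 // => i _.
  by rewrite big_bool /=; lra.
have pk : (0 : R) < (2 ^ k)%:R by rewrite ltr0n expn_gt0.
have lnr x : ln (r x) = \sum_i ln (w (x i)) by rewrite /r ln_prodr.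
have ln2k : ln ((2 ^ k)%:R : R) = k%:R * ln 2 by rewrite natrX lnXn // mulr_natl.
(* Apply [ln y <= y - 1] at [y = r x 2 ^ k]; then [q (r 2 ^ k - 1) <= r - q] because [q 2 ^ k <= 1],
   and [r - q] sums to zero. *)
have gibbs : \sum_x q x * (ln (r x) + k%:R * ln 2) <= 0.
  apply: (@le_trans _ _ (\sum_x (r x - q x))); last by rewrite sumrB r1 q1 subrr.
  apply: ler_sum => x _; rewrite -ln2k -lnM ?posrE //.
  have rk : 0 < r x * (2 ^ k)%:R by rewrite mulr_gt0.
  have : ln (1 + (r x * (2 ^ k)%:R - 1)) <= r x * (2 ^ k)%:R - 1.
    by apply: le_ln1Dx; lra.
  rewrite addrC subrK => /(ler_wpM2l (q0 x)) /le_trans; apply.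
  by have := ler_wpM2l (ltW (r0 x)) (qmax x); lra.
have expect : \sum_x q x * ln (r x) >= n%:R * (p * ln p + (1 - p) * ln (1 - p)).
  under eq_bigr do rewrite lnr mulr_sumr.
  rewrite exchange_big /=.
  have -> : n%:R * (p * ln p + (1 - p) * ln (1 - p)) =
      \sum_(i < n) (p * ln p + (1 - p) * ln (1 - p)).
    by rewrite sumr_const card_ord mulr_natl.
  apply: ler_sum => i _; rewrite (bigID (fun x : bits n => x i)) /=.
  have -> : \sum_(x : bits n | x i) q x * ln (w (x i)) = (\sum_(x : bits n | x i) q x) * ln p.
    by rewrite mulr_suml; apply: eq_bigr => x ->.
  have -> : \sum_(x : bits n | ~~ x i) q x * ln (w (x i)) =
      (\sum_(x : bits n | ~~ x i) q x) * ln (1 - p).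
    by rewrite mulr_suml; apply: eq_bigr => x /negPf ->.
  move: q1; rewrite (bigID (fun x : bits n => x i)) /= => q1i.
  (* Here [p <= 1 / 2] enters: as [ln p <= ln (1 - p)], a marginal [a] below [p] only raises
     [a ln p + (1 - a) ln (1 - p)]. *)
  have lnp : ln p <= ln (1 - p) by rewrite ler_ln ?posrE; lra.
  have := marginal i; set a := \sum_(x : bits n | x i) q x in q1i *.
  set b := \sum_(x | _) q x in q1i * => ap.
  have -> : b = 1 - a by lra.
  have pa : 0 <= p - a by lra.
  by have := ler_wpM2l pa lnp; lra.
move: gibbs; under eq_bigr do rewrite mulrDr.
by rewrite big_split /= -mulr_suml q1 mul1r; lra.
Qed.

Lemma marginals_entropy_bound : 0 <= p -> p <= 1 / 2 -> k%:R <= n%:R * H2 p.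
Proof.
rewrite le_eqVlt => /predU1P[p0 _|p0 p2]; last first.
  have ln2 : 0 < ln 2 :> R by rewrite ln_gt0 // ltr1n.
  rewrite -(ler_pM2r ln2); apply: le_trans (bernoulli_entropy_bound p0 p2) _.
  by rewrite /H2 /log2 le_eqVlt; apply/orP; left; apply/eqP; field; lra.
(* At [p = 0] the Bernoulli weights degenerate. All marginals vanish, so [q] is the point mass at
   the zero string, and [q <= 2 ^- k] forces [k = 0]. *)
have q_eq0 x : x != [ffun=> false] -> q x = 0.
  move=> xn0; have [i xi] : exists i, x i.
    apply/existsP; apply: contraNT xn0 => /existsPn xi.
    by apply/eqP/ffunP => i; rewrite ffunE; apply/negbTE.
  apply/eqP; rewrite eq_le q0 andbT; apply: le_trans (_ : p <= 0); last by rewrite -p0.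
  by apply: le_trans (marginal i); rewrite (bigD1 x) //= lerDl sumr_ge0.
have := qmax [ffun=> false]; have : q [ffun=> false] = 1.
  by rewrite -q1 (bigD1 [ffun=> false]) //= big1 ?addr0.
move=> ->; rewrite mul1r -p0 lern1 => k2.
have -> : k = 0%N by case: k k2 => // k'; rewrite expnS; have := expn_gt0 2 k'; lia.
by rewrite /H2 /log2 !(oppr0, mul0r, addr0, ln1, mulr0, subr0).
Qed.

End Entropy.

(** * Code states and finiteness of the subsystem variance *)

Section Code.
Variables (R : realType) (n : nat).
Local Notation C := (R[i]).

Lemma op_tr_proj T (X : op R T) (v : vec R T) :
  op_tr (op_mul X (proj_op v)) = inner v (op_app X v).
Proof.
rewrite /op_tr /op_mul /inner /op_app /proj_op; apply: eq_bigr => x _.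
by rewrite mulr_sumr; apply: eq_bigr => y _; ring.
Qed.

Lemma op_tr_subr T (X A B : op R T) :
  op_tr (op_mul X (op_sub A B)) = op_tr (op_mul X A) - op_tr (op_mul X B).
Proof.
rewrite /op_tr -sumrB; apply: eq_bigr => x _; rewrite /op_mul -sumrB.
by apply: eq_bigr => y _; rewrite /op_sub mulrBr.
Qed.

Lemma op_tr_code_mixed m (basis : 'I_m -> vec R (bits n)) (X : op R (bits n)) :
  op_tr (op_mul X (code_mixed basis)) =
  m%:R^-1 * \sum_(j < m) inner (basis j) (op_app X (basis j)).
Proof.
under [X in _ = _ * X]eq_bigr do rewrite -op_tr_proj.
rewrite /op_tr [X in _ = _ * X]exchange_big mulr_sumr; apply: eq_bigr => x _ /=.
rewrite /op_mul exchange_big mulr_sumr; apply: eq_bigr => y _ /=.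
by rewrite /code_mixed /proj_op mulrCA -mulr_sumr.
Qed.

Section SpectralSum.
Variables (I : finType) (s : I -> C) (u : I -> vec R (bits n)).

Lemma op_app_spectral_sum v :
  op_app (spectral_sum s u) v = fun x => \sum_t (s t * inner (u t) v) * u t x.
Proof.
apply/funext => x; rewrite /op_app /spectral_sum; under eq_bigr do rewrite mulr_suml.
rewrite exchange_big; apply: eq_bigr => t _; rewrite /inner -mulrA mulr_suml mulr_sumr.
by apply: eq_bigr => y _; ring.
Qed.

Lemma inner_spectral_sum v :
  inner v (op_app (spectral_sum s u) v) = \sum_t s t * `|inner (u t) v| ^+ 2.
Proof.
rewrite op_app_spectral_sum inner_sumr; apply: eq_bigr => t _.
by rewrite -(inner_conj (u t) v) -mulrA -normCK.
Qed.

Lemma contraction_spectral_sum : is_orthonormal u -> (forall t, `|s t| <= 1) ->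
  contraction (spectral_sum s u).
Proof.
move=> uON s1 v; rewrite op_app_spectral_sum inner_orthonormal //.
apply: le_trans (bessel v uON); apply: ler_sum => t _.
by rewrite normrM exprMn ler_piMl ?exprn_ge0 // exprn_ile1.
Qed.

End SpectralSum.

Lemma norm_unit_vec_le1 (v : vec R (bits n)) x : inner v v = 1 -> `|v x| <= 1.
Proof.
move=> v1; rewrite -(@ler_pXn2r _ 2%N) ?nnegrE // expr1n -v1 inner_normE.
by rewrite (bigD1 x) //= lerDl sumr_ge0 // => y _; rewrite exprn_ge0.
Qed.

(** A supremum dominates the elements of its set only when the set is bounded above. The bound found
    for each [S] is summed over all [S] to become uniform. *)
Lemma subsys_values_ubound m (G : rel 'I_n) (basis : 'I_m -> vec R (bits n)) d :
  has_ubound (subsys_values G basis d).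
Proof.
pose N : R := #|bits n|%:R.
(* An entry of the reduced state of a unit vector is a sum of at most [N] terms of modulus at most
   1; [B] is the resulting value of the bound in [trnorm_le]. *)
pose M (S : {set 'I_n}) : C := \sum_(a : sbits S) \sum_(b : sbits S)
  ((N%:C)%C + `|@ptrace R n S (code_mixed basis) a b|) ^+ 2.
pose B (S : {set 'I_n}) : C := #|sbits S|%:R + M S.
exists (\sum_S complex.Re (B S)) => _ [psi [S [[_ psi1] _ _ ->]]].
have B0 T : 0 <= B T.
  rewrite addr_ge0 // sumr_ge0 // => a _; rewrite sumr_ge0 // => b _.
  by rewrite exprn_ge0 // addr_ge0 // ler0c.
have ReB T : (complex.Re (B T))%:C%C = B T by rewrite RRe_real // ger0_real.
suff H : (trnorm (op_sub (@ptrace R n S (proj_op psi)) (@ptrace R n S (code_mixed basis))))%:C%C <= B S.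
  rewrite (bigD1 S) //= -[leLHS]addr0 lerD //; first by rewrite -lecR ReB.
  by rewrite sumr_ge0 // => T _; rewrite -ler0c ReB.
apply: le_trans (trnorm_le _) _; rewrite lerD2l; apply: ler_sum => a _; apply: ler_sum => b _.
rewrite ler_pXn2r ?nnegrE //; last by rewrite addr_ge0 // ler0c.
apply: le_trans (ler_normB _ _) _; rewrite lerD2r /ptrace.
apply: le_trans (ler_norm_sum _ _ _) _.
apply: (@le_trans _ _ (\sum_(x : bits n) 1)); last by rewrite sumr_const /N rmorph_nat.
rewrite [leRHS](bigID (fun x => @restr n S x == a)) /= -[leLHS]addr0.
rewrite lerD ?sumr_ge0 //; apply: ler_sum => x _.
by rewrite /proj_op normrM norm_conjC mulr_ile1 // norm_unit_vec_le1.
Qed.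

End Code.

(** * Evolved observables and the measured code distribution *)

Section LightCone.
Variables (R : realType) (n m : nat) (G : rel 'I_n).
Hypotheses (Gsym : forall i j, G i j = G j i) (Girr : forall i, G i i = false).
Variables (basis : 'I_m -> vec R (bits n)) (c : seq (seq (gate R n))).
Hypothesis c_ok : forall L, List.In L c -> layer_ok G L.
Local Notation C := (R[i]).

(** The columns of the circuit unitary: [out t] is [U |t>]. *)
Definition out (t : bits n) : vec R (bits n) := run c (@ket R n t).
Definition sign_at (i : 'I_n) (x : bits n) : C := (-1) ^+ x i.
(* [U Z_i U^dagger], where [U] is the unitary of the circuit *)
Definition heisenberg_Z i : op R (bits n) := spectral_sum (sign_at i) out.

Lemma orthonormal_out : is_orthonormal out.
Proof. by move=> s t; rewrite /out (inner_run Girr) // orthonormal_ket. Qed.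

Lemma inner_ket t (v : vec R (bits n)) : inner (@ket R n t) v = v t.
Proof.
rewrite /inner /ket -(sum_delta v); apply: eq_bigr => x _.
by rewrite rmorph_nat eq_sym.
Qed.

(** The projectors on the [out t] sum to [U 1 U^dagger], which is the identity again. *)
Lemma parseval_out v : \sum_t `|inner (out t) v| ^+ 2 = inner v v.
Proof.
have E : spectral_sum (fun=> 1) out = spectral_sum (fun=> 1) (@ket R n).
  rewrite -conj_circuit_sum (conj_circuit_trivial Girr c_ok) // => j.
  exact: trivial_at_spectral_sum_ket.
transitivity (inner v (op_app (spectral_sum (fun=> 1) out) v)).
  by rewrite inner_spectral_sum; apply: eq_bigr => t _; rewrite mul1r.
rewrite E inner_spectral_sum inner_normE; apply: eq_bigr => t _.
by rewrite inner_ket mul1r.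
Qed.

Lemma contraction_heisenberg_Z i : contraction (heisenberg_Z i).
Proof.
apply: contraction_spectral_sum orthonormal_out _ => t.
by rewrite normrX normrN1 expr1n.
Qed.

Lemma heisenberg_Z_local i j : j \notin ball G i (size c) ->
  trivial_at j (heisenberg_Z i).
Proof.
rewrite /heisenberg_Z -conj_circuit_sum => jb.
apply: (trivial_at_conj_circuit Gsym c_ok) jb => q qi.
apply: trivial_at_spectral_sum_ket => x a.
by rewrite /sign_at ffunE eq_sym (negPf qi).
Qed.

(** The circuit prepares [out] at the zero string, an eigenvector whose sign at [i] is [+1]. *)
Lemma heisenberg_Z_run i : inner (run_circuit c) (op_app (heisenberg_Z i) (run_circuit c)) = 1.
Proof.
have -> : run_circuit c = out [ffun=> false] by [].
set o : bits n := [ffun=> false].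
rewrite op_app_spectral_sum inner_sumr (bigD1 o) //= big1 ?addr0 => [|t to]; last first.
  by rewrite !orthonormal_out (negPf to) mulr0 mul0r.
by rewrite !orthonormal_out eqxx /sign_at ffunE expr0 !mulr1.
Qed.

(* Distribution of the measured bits when the circuit is undone on the maximally
   mixed code state. *)
Definition code_dist (x : bits n) : R :=
  complex.Re (m%:R^-1 * \sum_(j < m) `|inner (out x) (basis j)| ^+ 2).

Lemma code_distE x :
  (code_dist x)%:C%C = m%:R^-1 * \sum_(j < m) `|inner (out x) (basis j)| ^+ 2.
Proof.
rewrite RRe_real // ger0_real // mulr_ge0 ?invr_ge0 ?ler0n // sumr_ge0 // => j _.
by rewrite exprn_ge0.
Qed.

Lemma code_dist_ge0 x : 0 <= code_dist x.
Proof.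
rewrite -ler0c code_distE mulr_ge0 ?invr_ge0 ?ler0n // sumr_ge0 // => j _.
by rewrite exprn_ge0.
Qed.

Lemma op_tr_heisenberg_Z i :
  op_tr (op_mul (heisenberg_Z i) (code_mixed basis)) =
  (\sum_(x : bits n) (-1) ^+ x i * code_dist x)%:C%C.
Proof.
rewrite op_tr_code_mixed rmorph_sum /=.
under eq_bigr do rewrite inner_spectral_sum.
rewrite exchange_big mulr_sumr; apply: eq_bigr => x _ /=.
rewrite rmorphM /= code_distE -mulr_sumr mulrCA; congr (_ * _).
by rewrite rmorphXn rmorphN1.
Qed.

Hypothesis basisON : orthonormal_family basis.

Lemma sum_code_dist : (0 < m)%N -> \sum_x code_dist x = 1.
Proof.
move=> m0; apply: complexI; rewrite rmorph_sum /=.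
under eq_bigr do rewrite code_distE.
rewrite -mulr_sumr exchange_big /=; under eq_bigr do rewrite parseval_out basisON eqxx.
by rewrite sumr_const card_ord mulVf // pnatr_eq0 -lt0n.
Qed.

(** Bessel's inequality with the roles exchanged: the unit vector [out x] is expanded along the code
    basis. *)
Lemma code_dist_le x : code_dist x * m%:R <= 1.
Proof.
case: (posnP m) => [->|m0]; first by rewrite mulr0 ler01.
rewrite -lecR rmorphM /= code_distE rmorph_nat mulrAC mulVf ?mul1r; last first.
  by rewrite pnatr_eq0 -lt0n.
apply: le_trans (_ : inner (out x) (out x) <= _); last by rewrite orthonormal_out eqxx.
apply: le_trans (bessel (out x) (basisON : is_orthonormal basis)).
by apply: ler_sum => j _; rewrite -(inner_conj (basis j)) norm_conjC.
Qed.

(** The mean of the evolved observable is 1 in the circuit output, [w] in [psi] and [z] in the mixed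
    code state. The two passages cost at most [delta] and the subsystem variance. *)
Lemma code_dist_marginal_le d (delta : R) psi i : (0 < m)%N ->
  code_state basis psi -> (#|ball G i (size c)| <= d)%N ->
  trnorm (op_sub (proj_op (run_circuit c)) (proj_op psi)) <= delta ->
  \sum_(x : bits n | x i) code_dist x <= subsys_variance G basis d / 2 + delta / 2.
Proof.
move=> m0 psiC Sd close; set S := ball G i (size c) in Sd; set e := subsys_variance _ _ _.
set z := \sum_(x : bits n) (-1) ^+ x i * code_dist x.
(* The mean of a sign is one minus twice the probability of the bit 1; this is where the halves in
   the bound come from. *)
have zE : z = 1 - 2 * \sum_(x : bits n | x i) code_dist x.
  have := sum_code_dist m0; rewrite /z !(bigID (fun x : bits n => x i) xpredT) /=.
  rewrite [X in _ -> X + _ = _](eq_bigr (fun x => - code_dist x)); last first.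
    by move=> x ->; rewrite expr1 mulN1r.
  rewrite [X in _ -> _ + X = _](eq_bigr code_dist); last first.
    by move=> x /negPf ->; rewrite expr0 mul1r.
  by rewrite sumrN; lra.
suff : 1 - z <= delta + e by rewrite zE; lra.
set w := op_tr (op_mul (heisenberg_Z i) (proj_op psi)).
have w1 : `|1 - w| <= delta%:C%C.
  have := trace_le_trnorm (op_sub (proj_op (run_circuit c)) (proj_op psi))
    (contraction_heisenberg_Z i).
  by rewrite op_tr_subr op_tr_proj heisenberg_Z_run => /le_trans; apply; rewrite lecR.
(* The observable lives on the ball [S], so both means are computed from reduced states on [S], a
   connected set of at most [d] qubits. *)
have wz : `|w - z%:C%C| <= e%:C%C.
  have loc j : j \notin S -> trivial_at j (heisenberg_Z i) by exact: heisenberg_Z_local.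
  rewrite -op_tr_heisenberg_Z -(op_tr_ptrace _ loc) /w -(op_tr_ptrace _ loc) -op_tr_subr.
  apply: le_trans (trace_le_trnorm _ (contraction_compress (contraction_heisenberg_Z i))) _.
  rewrite lecR; apply: ub_le_sup; first exact: subsys_values_ubound.
  by exists psi, S; split => //; apply: ball_connected.
rewrite -lecR; apply: le_trans (_ : `|(1 - z)%:C%C| <= _).
  by rewrite real_ler_norm // complex_real.
have -> : (1 - z)%:C%C = (1 - w) + (w - z%:C%C).
  by rewrite rmorphB rmorph1 addrA subrK.
by rewrite rmorphD; apply: le_trans (ler_normD _ _) _; apply: lerD.
Qed.

End LightCone.

(** * The lower bound on robust circuit complexity *)

Theorem theorem2 (R : realType) (D n k : nat) (G : rel 'I_n)
  (basis : 'I_(2 ^ k) -> vec R (bits n)) (d : nat) (delta : R) :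
  (0 < D)%N -> (k < n)%N -> lattice_graph D G -> orthonormal_family basis ->
  (1 <= d)%N -> 0 <= delta ->
  subsys_variance G basis d + delta < 1 ->
  H2 (subsys_variance G basis d / 2 + delta / 2) < k%:R / n%:R ->
  forall psi : vec R (bits n), code_state basis psi ->
    robust_complexity_gt G delta psi
      ((powR (d%:R : R) (D%:R^-1) - 1) / 2).
Proof.
move=> D0 kn latG basisON d1 delta0 e1 Hkn psi psiC psi' l _ close [c [<- [ok cpsi]]].
have [Gsym [Girr _]] := latG; rewrite -cpsi in close.
rewrite ltNge; apply/negP => lr.
(* A depth [l <= (d^(1/D) - 1) / 2] means [2 l + 1 <= d^(1/D)]; raising to the power [D] bounds
   every light cone by [d] qubits. *)
have card i : (#|ball G i (size c)| <= d)%N.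
  apply: leq_trans (card_ball _ _ latG) _; rewrite -(ler_nat R) natrX natrD natrM.
  have lr' : 2 * (size c)%:R + 1 <= powR (d%:R : R) D%:R^-1 by lra.
  have := lerXn2r D _ _ lr'; rewrite !nnegrE addr_ge0 // ?mulr_ge0 // powR_ge0.
  move=> /(_ isT isT) /le_trans; apply.
  by rewrite -powR_mulrn ?powR_ge0 // -powRrM mulVf ?powRr1 // pnatr_eq0 -lt0n.
have m0 : (0 < 2 ^ k)%N by rewrite expn_gt0.
have n0 : (0 < n)%N by lia.
have marg (i : 'I_n) := code_dist_marginal_le Gsym Girr ok basisON m0 psiC (card i) close.
(* Nonnegative because it dominates a marginal probability, at a qubit that exists since [k < n]. *)
have p0 : 0 <= subsys_variance G basis d / 2 + delta / 2.
  apply: le_trans (marg (Ordinal n0)); apply: sumr_ge0 => x _.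
  exact: code_dist_ge0.
have p2 : subsys_variance G basis d / 2 + delta / 2 <= 1 / 2 by lra.
have := marginals_entropy_bound (code_dist_ge0 basis c)
  (sum_code_dist Girr ok basisON m0) (code_dist_le Girr ok basisON) marg p0 p2.
by move: Hkn; rewrite ltr_pdivlMr ?ltr0n // mulrC ltNge => /negP.
Qed.
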